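(* Let $(P,[\cdot,\cdot])$ be a Leibniz manifold and $\mathfrak{g}$ a Lie algebra acting on $P$. Assume that the $\mathfrak{g}$-action on $P$ admits a momentum map $\mathbf{J}:P\to\mathfrak{g}^{\ast}$. Then the level sets of $\mathbf{J}$ are preserved by the flow of the Leibniz vector field $X_h^R$ associated to any $\mathfrak{g}$-invariant function $h\in C^{\infty}(P)^{\mathfrak{g}}$.
   Context: A Leibniz manifold $(P,[\cdot,\cdot])$ is a smooth manifold $P$ with an $\mathbb{R}$-bilinear map $[\cdot,\cdot]:C^{\infty}(P)\times C^{\infty}(P)\to C^{\infty}(P)$ that is a derivation in each entry: $[fg,h]=[f,h]g+f[g,h]$ and $[f,gh]=g[f,h]+h[f,g]$ (no antisymmetry or Jacobi identity is required). For $h\in C^\infty(P)$, the vector fields $X_h^R$ and $X_h^L$ on $P$ are uniquely determined by $X_h^R[f]=[f,h]$ and $X_h^L[f]=-[h,f]$ for all $f\in C^{\infty}(P)$. The Leibniz vector field associated to $h$ is $X_h:=X_h^R$. A right (left) action of a Lie algebra $\mathfrak{g}$ on $P$ is a Lie algebra (anti)homomorphism $\xi\in\mathfrak{g}\mapsto\xi_P\in\mathfrak{X}(P)$ such that the map $(m,\xi)\in P\times\mathfrak{g}\mapsto\xi_P(m)\in TP$ is smooth. The set of $\mathfrak{g}$-invariant functions is $C^{\infty}(P)^{\mathfrak{g}}:=\{f\in C^{\infty}(P)\mid \mathbf{d}f\cdot\xi_P=0\text{ for any }\xi\in\mathfrak{g}\}$. No compatibility between the action and the bracket is assumed. The $\mathfrak{g}$-action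 is said to admit a momentum map $\mathbf{J}:P\to\mathfrak{g}^{\ast}$ if for every $\xi\in\mathfrak{g}$ there is a smooth function $f_\xi\in C^{\infty}(P)$ such that the component $\mathbf{J}^{\xi}:=\langle\mathbf{J},\xi\rangle$ is smooth and $X^L_{\mathbf{J}^{\xi}}=f_\xi\,\xi_P$. *)

(* Defs.v *)
From HB Require Import structures.
From mathcomp Require Import all_boot all_order all_algebra.
From mathcomp Require Import all_classical all_reals all_analysis.
Set Implicit Arguments.
Unset Strict Implicit.
Unset Printing Implicit Defensive.
Import Order.TTheory GRing.Theory Num.Theory numFieldNormedType.Exports.
Local Open Scope classical_set_scope.
Local Open Scope ring_scope.

Section Smooth.
Context {R : realType} {V W : normedModType R}.
Implicit Types (U : set V) (f : V -> W).

(* Meant for an open set U of a finite-dimensional space V. *)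
Fixpoint Ck (k : nat) U f : Prop :=
  if k is k'.+1 then
    (forall x, U x -> differentiable f x) /\ (forall v, Ck k' U ('D_v f))
  else forall x, U x -> {for x, continuous f}.

Definition smooth_on U f := forall k, Ck k U f.

Lemma near_eq_differentiable f g x :
  (\forall y \near x, f y = g y) -> differentiable f x -> differentiable g x.
Proof.
move=> fg df; have -> : g = f + (g - f) by rewrite addrC subrK.
apply: differentiableD => //; set e := g - f.
have e0 : \forall y \near x, e y = 0.
  by apply: filterS fg => y fy; rewrite /e !fctE fy subrr.
have elin : e \o shift x = cst (e x) + (\0 : {linear V -> W}) +o_ 0 id.
  apply/eqaddoP => _/posnumP[eps].
  have : \forall h \near 0, e (h + x) = 0.
    by have := e0; rewrite (near_shift 0 x) subr0.
  apply: filterS => h eh.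
  rewrite !fctE /= eh (nbhs_singleton e0) addr0 subrr normr0.
  by rewrite mulr_ge0.
apply/diff_locallyP; rewrite (diff_unique _ elin)//; first split => //.
all: exact: cst_continuous.
Qed.

Lemma eq_Ck k U f g : open U -> (forall x, U x -> f x = g x) ->
  Ck k U f -> Ck k U g.
Proof.
move=> oU; have near_fg h1 h2 x : (forall y, U y -> h1 y = h2 y) -> U x ->
    \forall y \near x, h1 y = h2 y :> W.
  move=> h12 Ux; have := open_nbhs_nbhs (conj oU Ux).
  by apply: filterS => y /h12.
elim: k f g => [|k IHk] f g fg /=.
  move=> cf x Ux; rewrite /prop_for /continuous_at -fg//.
  apply: cvg_trans (cf x Ux); apply: near_eq_cvg.
  exact: near_fg.
move=> [df Df]; split=> [x Ux|v].
  by apply: near_eq_differentiable (df x Ux); exact: near_fg.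
apply: IHk (Df v) => x Ux; apply: near_eq_derive; exact: near_fg.
Qed.

Lemma Ck_le k U f : Ck k.+1 U f -> Ck k U f.
Proof.
elim: k f => [|k IHk] f [df Df] /=.
  by move=> x Ux; apply: differentiable_continuous; exact: df.
by split=> // v; exact: IHk.
Qed.

Lemma Ck_cst k U (c : W) : Ck k U (cst c).
Proof.
elim: k c => [|k IHk] c /=; first by move=> x _; exact: cst_continuous.
split=> [x _|v]; first exact: differentiable_cst.
have -> : 'D_v (cst c) = cst 0 :> (V -> W) by apply/funext => x; rewrite derive_cst.
exact: IHk.
Qed.

Lemma CkD k U f g : open U -> Ck k U f -> Ck k U g -> Ck k U (f + g).
Proof.
move=> oU; elim: k f g => [|k IHk] f g /=.
  by move=> cf cg x Ux; apply: cvgD; [exact: cf | exact: cg].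
move=> [df Df] [dg Dg]; split=> [x Ux|v].
  by apply: differentiableD; [exact: df | exact: dg].
apply: (@eq_Ck k U ('D_v f + 'D_v g)) (IHk _ _ (Df v) (Dg v)) => // x Ux.
by rewrite deriveD//; apply: diff_derivable; [exact: df | exact: dg].
Qed.

Lemma CkZ k U (a : R) f : open U -> Ck k U f -> Ck k U (a *: f).
Proof.
move=> oU; elim: k f => [|k IHk] f /=.
  by move=> cf x Ux; apply: cvgZr; exact: cf.
move=> [df Df]; split=> [x Ux|v].
  by apply: differentiableZ; exact: df.
apply: (@eq_Ck k U (a *: 'D_v f)) (IHk _ (Df v)) => // x Ux.
by rewrite deriveZ//; apply: diff_derivable; exact: df.
Qed.
End Smooth.

Lemma CkM (R : realType) (V : normedModType R) k (U : set V) (f g : V -> R) :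
  open U -> Ck k U f -> Ck k U g -> Ck k U (f * g).
Proof.
move=> oU; elim: k f g => [|k IHk] f g.
  move=> cf cg x Ux; exact: (@continuousM _ _ f g x (cf x Ux) (cg x Ux)).
move=> Cf Cg; have [[df Df] [dg Dg]] := (Cf, Cg); split=> [x Ux|v].
  by apply: differentiableM; [exact: df | exact: dg].
apply: (@eq_Ck _ _ _ k U (f * 'D_v g + g * 'D_v f)) => // [x Ux|].
  by rewrite deriveM//; apply: diff_derivable; [exact: df | exact: dg].
by apply: CkD => //; apply: IHk; try exact: Ck_le; [exact: Dg | exact: Df].
Qed.

Section Manifold.
Context (R : realType) (n : nat).

Record chart (P : topologicalType) := Chart {
  chart_dom : set P;
  chart_map :> P -> 'rV[R]_n;
  chart_inv : 'rV[R]_n -> P;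
  chart_dom_open : open chart_dom;
  chart_img_open : open (chart_map @` chart_dom);
  chart_mapK : forall m, chart_dom m -> chart_inv (chart_map m) = m;
  chart_map_continuous : {within chart_dom, continuous chart_map};
  chart_inv_continuous :
    {within chart_map @` chart_dom, continuous chart_inv} }.

Definition chart_img (P : topologicalType) (phi : chart P) : set 'rV[R]_n :=
  phi @` chart_dom phi.

Record manifold := Manifold {
  manifold_top :> topologicalType;
  manifold_hausdorff : hausdorff_space manifold_top;
  manifold_second_countable : @second_countable manifold_top;
  atlas : set (chart manifold_top);
  atlas_cover : forall m, exists2 phi, atlas phi & chart_dom phi m;
  atlas_compatible : forall phi psi, atlas phi -> atlas psi ->
    smooth_on (phi @` (chart_dom phi `&` chart_dom psi))
              (psi \o chart_inv phi) }.

Definition smooth (P : manifold) : {pred P -> R} := fun f =>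
  `[< forall phi, atlas phi -> smooth_on (chart_img phi) (f \o chart_inv phi) >].

End Manifold.

Section Cinfty.
Context (R : realType) (n : nat) (P : manifold R n).

Lemma smooth_subring_closed : subring_closed (@smooth R n P).
Proof.
split.
- by apply/asboolP => phi _ k; exact: Ck_cst.
- move=> f g /asboolP sf /asboolP sg; apply/asboolP => phi aphi k.
  have oI := @chart_img_open _ _ _ phi.
  rewrite -scaleN1r; apply: (CkD oI); first exact: sf.
  by apply: (@CkZ _ _ _ k _ (-1) _ oI); exact: sg.
- move=> f g /asboolP sf /asboolP sg; apply/asboolP => phi aphi k.
  by apply: (CkM (@chart_img_open _ _ _ phi)); [exact: sf | exact: sg].
Qed.
HB.instance Definition _ :=
  GRing.isSubringClosed.Build _ (@smooth R n P) smooth_subring_closed.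

Lemma smooth_scaler_closed : GRing.scaler_closed (@smooth R n P).
Proof.
move=> a f /asboolP sf; apply/asboolP => phi aphi k.
by apply: (CkZ a (@chart_img_open _ _ _ phi)); exact: sf.
Qed.
HB.instance Definition _ :=
  GRing.isScaleClosed.Build R _ (@smooth R n P) smooth_scaler_closed.

Record Cinf := MkCinf { Cinf_fun :> P -> R; _ : Cinf_fun \in @smooth R n P }.
HB.instance Definition _ := [isSub for Cinf_fun].
HB.instance Definition _ := [Choice of Cinf by <:].
HB.instance Definition _ := GRing.SubChoice_isSubComPzRing.Build
  _ (@smooth R n P) Cinf smooth_subring_closed.
HB.instance Definition _ := [SubZmodule_isSubLmodule of Cinf by <:].

(* Vector fields are identified with the derivations of the algebra of smooth
   functions, X f being the function m |-> df(m).X(m); the tangent vector X(m)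
   is the derivation at m sending f to X f m. *)
Record vector_field := VectorField {
  vf_fun :> Cinf -> Cinf;
  vf_linear : linear vf_fun;
  vf_leibniz : forall f g, vf_fun (f * g) = vf_fun f * g + f * vf_fun g }.

Definition vf_bracket (X Y : vector_field) (f : Cinf) : Cinf :=
  X (Y f) - Y (X f).

(* In the chart phi, the tangent vector v at m is \sum_i a_i d/dx_i. *)
Definition tangent_coord (phi : chart R n P) (m : P) (v : Cinf -> R)
    (a : 'rV[R]_n) : Prop :=
  forall f : Cinf, v f = 'D_a (f \o chart_inv phi) (phi m).

Definition smooth_curve (I : set R) (c : R -> P) : Prop :=
  (forall t, I t -> {for t, continuous c}) /\
  (forall phi, atlas phi -> smooth_on (I `&` c @^-1` chart_dom phi) (phi \o c)).

(* The velocity c'(t) is the derivation f |-> (f o c)'(t) at c(t). *)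
Definition integral_curve (X : vector_field) (I : set R) (c : R -> P) : Prop :=
  smooth_curve I c /\
  (forall t, I t -> forall f : Cinf, is_derive t 1 (f \o c) (X f (c t))).

Definition joined_at (X : vector_field) (t : R) (m m' : P) : Prop :=
  exists (I : set R) (c : R -> P),
    [/\ open I, is_interval I, I 0 & I t] /\
    [/\ integral_curve X I c, c 0 = m & c t = m'].

(* The maximal (local) flow: m is in flow_domain X t when the maximal integral
   curve starting at m is defined at time t, and flow X t m is then its value at
   t, the only m' with joined_at X t m m' since integral curves are unique. *)
Definition flow_domain (X : vector_field) (t : R) : set P :=
  [set m | exists m', joined_at X t m m'].

Definition flow (X : vector_field) (t : R) (m : P) : P :=
  xget m (joined_at X t m).

Definition preserved_by_flow (X : vector_field) (S : set P) : Prop :=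
  forall t : R, flow X t @` (S `&` flow_domain X t) `<=` S.

Record leibniz_bracket := LeibnizBracket {
  lbr :> Cinf -> Cinf -> Cinf;
  lbr_linearl : forall h, linear (lbr^~ h);
  lbr_linearr : forall f, linear (lbr f);
  lbr_leibnizl : forall f g h, lbr (f * g) h = lbr f h * g + f * lbr g h;
  lbr_leibnizr : forall f g h, lbr f (g * h) = g * lbr f h + h * lbr f g }.

Section LeibnizVectorFields.
Variables (br : leibniz_bracket) (h : Cinf).

Let XR_fun (f : Cinf) : Cinf := br f h.
Let XL_fun (f : Cinf) : Cinf := - br h f.

Let XR_linear : linear XR_fun.
Proof. by move=> a f g; exact: (lbr_linearl br). Qed.

Let XR_leibniz f g : XR_fun (f * g) = XR_fun f * g + f * XR_fun g.
Proof. exact: lbr_leibnizl. Qed.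

Let XL_linear : linear XL_fun.
Proof. by move=> a f g; rewrite /XL_fun (lbr_linearr br) opprD scalerN. Qed.

Let XL_leibniz f g : XL_fun (f * g) = XL_fun f * g + f * XL_fun g.
Proof.
by rewrite /XL_fun lbr_leibnizr opprD mulrN mulNr addrC (mulrC g).
Qed.

Definition XR : vector_field := VectorField XR_linear XR_leibniz.
Definition XL : vector_field := VectorField XL_linear XL_leibniz.

End LeibnizVectorFields.
End Cinfty.

Record lie_algebra (R : realType) := LieAlgebra {
  lie_vect :> vectType R;
  lie_br : lie_vect -> lie_vect -> lie_vect;
  lie_linearl : forall y, linear (lie_br^~ y);
  lie_linearr : forall x, linear (lie_br x);
  lie_alternating : forall x, lie_br x x = 0;
  lie_jacobi : forall x y z,
    lie_br x (lie_br y z) + lie_br y (lie_br z x) + lie_br z (lie_br x y) = 0 }.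

Section Action.
Context (R : realType) (n : nat) (P : manifold R n) (g : lie_algebra R).

Definition lie_coord (y : 'rV[R]_(\dim {:g})) : g :=
  \sum_i y 0 i *: (vbasis {:g})`_i.

(* Smoothness of (m, xi) |-> xi_P(m) from P x g to TP, read in the charts that
   an atlas of P and a basis of g induce on P x g and TP. *)
Definition smooth_action (xiP : g -> vector_field P) : Prop :=
  forall phi, atlas phi ->
    exists2 A : 'rV[R]_n * 'rV[R]_(\dim {:g}) -> 'rV[R]_n,
      smooth_on (chart_img phi `*` setT) A &
      forall m y, chart_dom phi m ->
        tangent_coord phi m (fun f => xiP (lie_coord y) f m) (A (phi m, y)).

(* Right actions are Lie algebra homomorphisms, left ones antihomomorphisms. *)
Record lie_action := LieAction {
  act :> g -> vector_field P;
  act_linear : forall a xi eta f,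
    act (a *: xi + eta) f = a *: act xi f + act eta f;
  act_bracket :
    (forall xi eta f, act (lie_br xi eta) f = vf_bracket (act xi) (act eta) f)
    \/
    (forall xi eta f, act (lie_br xi eta) f = - vf_bracket (act xi) (act eta) f);
  act_smooth : smooth_action act }.

Definition g_invariant (xiP : lie_action) (h : Cinf P) : Prop :=
  forall xi, xiP xi h = 0.

Definition momentum_map (br : leibniz_bracket P) (xiP : lie_action)
    (J : P -> 'Hom(g, R^o)) : Prop :=
  forall xi, exists fxi Jxi : Cinf P,
    (forall m, Jxi m = J m xi) /\
    (forall u, XL br Jxi u = fxi * xiP xi u).

End Action.

(* Main.v *)
Require Import Defs.
From mathcomp Require Import all_boot all_order all_algebra.
From mathcomp Require Import all_classical all_reals all_analysis.
Import Order.TTheory GRing.Theory Num.Theory numFieldNormedType.Exports.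
Local Open Scope classical_set_scope.
Local Open Scope ring_scope.

(** Along an integral curve of [X_h^R] the component [J^xi] has derivative
    [[J^xi, h] = - X^L_{J^xi}[h] = - f_xi xi_P[h]], and this vanishes because
    [h] is invariant.  So every component of [J] is a first integral of [X_h^R]
    ([momentum_first_integral]) and is therefore constant along integral curves
    ([first_integral_joined]).  A linear form on [g] is determined by its values,
    so [J] itself is constant along integral curves, in particular along the
    one that joins a point to its image under the flow. *)

(** The mean value theorem on the segment between the two points, which lies in
    [I] by convexity. *)
Lemma zero_derive_interval_cst (R : realType) (I : set R) (f : R -> R) :
  is_interval I -> (forall s, I s -> is_derive s 1 f 0) ->
  forall a b, I a -> I b -> f a = f b.
Proof.
move=> itvI df; suff le_cst a b : a <= b -> I a -> I b -> f a = f b.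
  move=> a b Ia Ib; case: (leP a b) => [ab|/ltW ba]; first exact: le_cst.
  by apply/esym/le_cst.
move=> ab Ia Ib; have Iab s : s \in `[a, b] -> I s.
  by rewrite in_itv => /(itvI _ _ Ia Ib).
have [s| |] := @MVT_segment R f (fun=> 0) a b ab.
- by move=> /subset_itv_oo_cc sab; exact/df/Iab.
- apply: derivable_within_continuous => s sab.
  by have [] := df s (Iab s sab).
by move=> c _ /eqP; rewrite mul0r subr_eq0 => /eqP.
Qed.

Lemma first_integral_joined (R : realType) (n : nat) (P : manifold R n)
    (X : vector_field P) (f : Cinf P) (t : R) (m m' : P) :
  X f = 0 -> joined_at X t m m' -> f m = f m'.
Proof.
move=> Xf0 [I [c [[_ itvI I0 It] [[_ dc] <- <-]]]].
apply: (@zero_derive_interval_cst R I (f \o c)) => // s Is.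
by have := dc s Is f; rewrite Xf0.
Qed.

(** The momentum condition concerns the left field of [J^xi] and the flow is that
    of the right field of [h], but both put [J^xi] in the first slot of the
    bracket and [h] in the second: [X_h^R[J^xi] = - X^L_{J^xi}[h]]. *)
Lemma momentum_first_integral (R : realType) (n : nat) (P : manifold R n)
    (br : leibniz_bracket P) (g : lie_algebra R) (xiP : lie_action P g)
    (xi : g) (h fxi Jxi : Cinf P) :
  g_invariant xiP h -> (forall u, XL br Jxi u = fxi * xiP xi u) ->
  XR br h Jxi = 0.
Proof.
move=> hinv XLJ; apply: oppr_inj; rewrite oppr0.
by have := XLJ h; rewrite hinv mulr0.
Qed.

Theorem proposition5p3 (R : realType) (n : nat) (P : manifold R n)
    (br : leibniz_bracket P) (g : lie_algebra R) (xiP : lie_action P g)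
    (J : P -> 'Hom(g, R^o)) (J_momentum : momentum_map br xiP J)
    (h : Cinf P) (h_invariant : g_invariant xiP h) (mu : 'Hom(g, R^o)) :
  preserved_by_flow (XR br h) (J @^-1` [set mu]).
Proof.
move=> t _ [m [/= <- m_dom] <-]; apply/lfunP => xi.
have m_joined : joined_at (XR br h) t m (flow (XR br h) t m) by exact: xgetPex.
have [fxi [Jxi [JE XLJ]]] := J_momentum xi.
rewrite -!JE; apply/esym; apply: first_integral_joined m_joined.
exact: momentum_first_integral h_invariant XLJ.
Qed.
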